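(* Let $V$ be a finite-dimensional $Y_\hbar(\mathfrak g)$-module with $\sigma(V)\subset\mathbb C^\times$. Then the $Y_\hbar(\mathfrak g)$-action on $V$ extends to a $\mathrm DY_\hbar(\mathfrak g)$-action, uniquely determined by the property that, for each $i\in\mathbf I$, the series $$\xi_i^-(u)\in\mathrm{End}(V)[[u]]\quad\text{and}\quad\mathcal X_i^\pm(u)_-\in\mathrm{End}(V)[[u]]$$ are the expansions at $0$ of the rational functions $\xi_i(u)$ and $x_i^\pm(u)$, respectively. Moreover, every finite-dimensional $\mathrm DY_\hbar(\mathfrak g)$-module arises in this way.
   Context: Let $\mathfrak g$ be a finite-dimensional simple Lie algebra over $\mathbb C$ with Cartan subalgebra $\mathfrak h$, simple roots $\{\alpha_i\}_{i\in\mathbf I}$, invariant form $(\cdot,\cdot)$ normalized so that short roots have squared length $2$, Cartan matrix $a_{ij}=2(\alpha_i,\alpha_j)/(\alpha_i,\alpha_i)$, and $d_i=(\alpha_i,\alpha_i)/2$. Fix $\hbar\in\mathbb C^\times$. The Yangian $Y_\hbar(\mathfrak g)$ is the unital associative $\mathbb C$-algebra generated by $\xi_{i,r},x_{i,r}^\pm$ ($i\in\mathbf I$, $r\in\mathbb Z_{\ge0}$) with relations, for all $i,j\in\mathbf I$, $r,s\ge0$: $[\xi_{i,r},\xi_{j,s}]=0$; $[\xi_{i,0},x_{j,s}^\pm]=\pm d_ia_{ij}x_{j,s}^\pm$; $[\xi_{i,r+1},x_{j,s}^\pm]-[\xi_{i,r},x_{j,s+1}^\pm]=\pm\hbar\frac{d_ia_{ij}}2(\xi_{i,r}x_{j,s}^\pm+x_{j,s}^\pm\xi_{i,r})$;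 $[x^\pm_{i,r+1},x_{j,s}^\pm]-[x^\pm_{i,r},x_{j,s+1}^\pm]=\pm\hbar\frac{d_ia_{ij}}2(x^\pm_{i,r}x_{j,s}^\pm+x_{j,s}^\pm x^\pm_{i,r})$; $[x_{i,r}^+,x_{j,s}^-]=\delta_{ij}\xi_{i,r+s}$; and for $i\ne j$, $m=1-a_{ij}$, $\sum_{\pi\in S_m}[x^\pm_{i,r_{\pi(1)}},[x^\pm_{i,r_{\pi(2)}},\cdots[x^\pm_{i,r_{\pi(m)}},x^\pm_{j,s}]\cdots]]=0$. Set $\xi_i(u)=1+\hbar\sum_{r\ge0}\xi_{i,r}u^{-r-1}$, $x_i^\pm(u)=\hbar\sum_{r\ge0}x_{i,r}^\pm u^{-r-1}$. On a finite-dimensional representation $V$ these are expansions at $u=\infty$ of $\mathrm{End}(V)$-valued rational functions (denoted by the same symbols); $\sigma_i(V)\subset\mathbb C$ is the set of all poles of $\xi_i(u),x_i^+(u),x_i^-(u)$, and $\sigma(V)=\bigcup_{i\in\mathbf I}\sigma_i(V)$. The Yangian double $\mathrm DY_\hbar(\mathfrak g)$ is the unital associative algebra generated by $\xi_{i,r},x_{i,r}^\pm$ with $i\in\mathbf I$, $r\in\mathbb Z$, subject to the same relations with all second indices ranging over $\mathbb Z$. There is a homomorphism $\imath:Y_\hbar(\mathfrak g)\to\mathrm DY_\hbar(\mathfrak g)$ sending each generator to the generator of the same name; ''extends'' means that the $Y_\hbar(\mathfrak g)$-action is the pull-back along $\imath$ of the $\mathrm DY_\hbar(\mathfrak g)$-action.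 In $\mathrm DY_\hbar(\mathfrak g)[[u]]$ set $\xi_i^-(u)=1-\hbar\sum_{r<0}\xi_{i,r}u^{-r-1}$ and $\mathcal X_i^\pm(u)_-=-\hbar\sum_{r<0}x_{i,r}^\pm u^{-r-1}$. *)

(* Defs.v *)
From HB Require Import structures.
From mathcomp Require Import all_boot all_order all_algebra.
From mathcomp Require Import perm complex.
From mathcomp Require Import boolp classical_sets reals.

Set Implicit Arguments.
Unset Strict Implicit.
Unset Printing Implicit Defensive.

Import Order.TTheory GRing.Theory Num.Theory.
Local Open Scope ring_scope.

(* Unital associative algebras given by generators and relations: the algebra
   is the quotient of the set of noncommutative polynomial expressions in the
   generators by the smallest congruence that contains the relations and the
   axioms of unital associative algebras. *)

Inductive alg_term (K G : Type) : Type :=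
| TGen of G
| TCst of K
| TAdd of alg_term K G & alg_term K G
| TMul of alg_term K G & alg_term K G.

Arguments TGen {K G}.
Arguments TCst {K G}.
Arguments TAdd {K G}.
Arguments TMul {K G}.

HB.instance Definition _ (K G : Type) := gen_eqMixin (alg_term K G).
HB.instance Definition _ (K G : Type) := gen_choiceMixin (alg_term K G).

Section TermOperations.
Variables (K : fieldType) (G : Type).
Implicit Types t u : alg_term K G.

Definition tscale (c : K) t := TMul (TCst c) t.
Definition tsub t u := TAdd t (tscale (-1) u).
Definition tcomm t u := tsub (TMul t u) (TMul u t).
Definition tanticomm t u := TAdd (TMul t u) (TMul u t).

End TermOperations.

Section PresentedAlgebra.
Variables (K : fieldType) (G : Type).
Variable rel : alg_term K G -> alg_term K G -> Prop.
Implicit Types t u v : alg_term K G.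

Inductive alg_cong : alg_term K G -> alg_term K G -> Prop :=
| cong_rel t u : rel t u -> alg_cong t u
| cong_refl t : alg_cong t t
| cong_sym t u : alg_cong t u -> alg_cong u t
| cong_trans t u v : alg_cong t u -> alg_cong u v -> alg_cong t v
| cong_add t t' u u' :
    alg_cong t t' -> alg_cong u u' -> alg_cong (TAdd t u) (TAdd t' u')
| cong_mul t t' u u' :
    alg_cong t t' -> alg_cong u u' -> alg_cong (TMul t u) (TMul t' u')
| cong_addA t u v : alg_cong (TAdd t (TAdd u v)) (TAdd (TAdd t u) v)
| cong_addC t u : alg_cong (TAdd t u) (TAdd u t)
| cong_add0 t : alg_cong (TAdd (TCst 0) t) t
| cong_addN t : alg_cong (TAdd (tscale (-1) t) t) (TCst 0)
| cong_mulA t u v : alg_cong (TMul t (TMul u v)) (TMul (TMul t u) v)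
| cong_mul1 t : alg_cong (TMul (TCst 1) t) t
| cong_mulDl t u v :
    alg_cong (TMul (TAdd t u) v) (TAdd (TMul t v) (TMul u v))
| cong_mulDr t u v :
    alg_cong (TMul t (TAdd u v)) (TAdd (TMul t u) (TMul t v))
| cong_cstD a b : alg_cong (TCst (a + b)) (TAdd (TCst a) (TCst b))
| cong_cstM a b : alg_cong (TCst (a * b)) (TMul (TCst a) (TCst b))
| cong_cstC a t : alg_cong (TMul (TCst a) t) (TMul t (TCst a)).

Definition alg_congb t u := `[< alg_cong t u >].

Lemma alg_congb_refl : reflexive alg_congb.
Proof. by move=> t; apply/asboolP/cong_refl. Qed.

Lemma alg_congb_sym : symmetric alg_congb.
Proof. by move=> t u; apply/asboolP/asboolP => /cong_sym. Qed.

Lemma alg_congb_trans : transitive alg_congb.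
Proof.
by move=> u t v /asboolP tu /asboolP uv; apply/asboolP/(cong_trans tu uv).
Qed.

Canonical alg_cong_equiv :=
  EquivRel alg_congb alg_congb_refl alg_congb_sym alg_congb_trans.

Definition presented := {eq_quot alg_congb}%qT.

HB.instance Definition _ := Choice.on presented.
HB.instance Definition _ := EqQuotient.on presented.

Definition tclass t : presented := (\pi_presented t)%qT.

Lemma tclass_eq t u : tclass t = tclass u <-> alg_cong t u.
Proof. by split=> [/eqmodP/asboolP|tu]; last exact/eqmodP/asboolP. Qed.

Lemma tclassK (x : presented) : tclass (repr x) = x.
Proof. exact: reprK. Qed.

Lemma repr_tclass t : alg_cong (repr (tclass t)) t.
Proof. by apply/tclass_eq; rewrite tclassK. Qed.

Definition padd (x y : presented) := tclass (TAdd (repr x) (repr y)).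
Definition pmul (x y : presented) := tclass (TMul (repr x) (repr y)).
Definition pscale (c : K) (x : presented) := tclass (tscale c (repr x)).
Definition popp (x : presented) := pscale (-1) x.

Lemma tclassD t u : tclass (TAdd t u) = padd (tclass t) (tclass u).
Proof. by apply/tclass_eq/cong_add; apply/cong_sym/repr_tclass. Qed.

Lemma tclassM t u : tclass (TMul t u) = pmul (tclass t) (tclass u).
Proof. by apply/tclass_eq/cong_mul; apply/cong_sym/repr_tclass. Qed.

Lemma pscaleE c x : pscale c x = pmul (tclass (TCst c)) x.
Proof. by rewrite -{2}(tclassK x) -tclassM. Qed.

Lemma tclassP (P : presented -> Prop) : (forall t, P (tclass t)) -> forall x, P x.
Proof. by move=> Pt x; rewrite -(tclassK x). Qed.

Lemma paddA : associative padd.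
Proof.
elim/tclassP => t; elim/tclassP => u; elim/tclassP => v.
by rewrite -!tclassD; apply/tclass_eq/cong_addA.
Qed.

Lemma paddC : commutative padd.
Proof.
by elim/tclassP => t; elim/tclassP => u; rewrite -!tclassD; apply/tclass_eq/cong_addC.
Qed.

Lemma padd0 : left_id (tclass (TCst 0)) padd.
Proof. by elim/tclassP => t; rewrite -tclassD; apply/tclass_eq/cong_add0. Qed.

Lemma paddN : left_inverse (tclass (TCst 0)) popp padd.
Proof.
elim/tclassP => t; rewrite /popp pscaleE -tclassM -tclassD.
exact/tclass_eq/cong_addN.
Qed.

Lemma pmulA : associative pmul.
Proof.
elim/tclassP => t; elim/tclassP => u; elim/tclassP => v.
by rewrite -!tclassM; apply/tclass_eq/cong_mulA.
Qed.

Lemma pmul1l : left_id (tclass (TCst 1)) pmul.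
Proof. by elim/tclassP => t; rewrite -tclassM; apply/tclass_eq/cong_mul1. Qed.

Lemma pcstC c x : pmul (tclass (TCst c)) x = pmul x (tclass (TCst c)).
Proof.
by elim/tclassP: x => t; rewrite -!tclassM; apply/tclass_eq/cong_cstC.
Qed.

Lemma pmul1r : right_id (tclass (TCst 1)) pmul.
Proof. by move=> x; rewrite -pcstC pmul1l. Qed.

Lemma pmulDl : left_distributive pmul padd.
Proof.
elim/tclassP => t; elim/tclassP => u; elim/tclassP => v.
by rewrite -!(tclassD, tclassM); apply/tclass_eq/cong_mulDl.
Qed.

Lemma pmulDr : right_distributive pmul padd.
Proof.
elim/tclassP => t; elim/tclassP => u; elim/tclassP => v.
by rewrite -!(tclassD, tclassM); apply/tclass_eq/cong_mulDr.
Qed.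

HB.instance Definition _ := GRing.isZmodule.Build presented
  paddA paddC padd0 paddN.
HB.instance Definition _ := GRing.Zmodule_isPzRing.Build presented
  pmulA pmul1l pmul1r pmulDl pmulDr.

Lemma pscaleA a b x : pscale a (pscale b x) = pscale (a * b) x.
Proof.
rewrite !pscaleE pmulA -tclassM; congr pmul.
exact/tclass_eq/cong_sym/cong_cstM.
Qed.

Lemma pscale1 : left_id 1 pscale.
Proof. by move=> x; rewrite pscaleE pmul1l. Qed.

Lemma pscaleDr : right_distributive pscale +%R.
Proof. by move=> c x y; rewrite !pscaleE; exact: pmulDr. Qed.

Lemma pscaleDl x : {morph pscale^~ x : a b / a + b}.
Proof.
move=> a b; rewrite !pscaleE -[RHS]pmulDl -tclassD; congr pmul.
exact/tclass_eq/cong_cstD.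
Qed.

HB.instance Definition _ := GRing.Zmodule_isLmodule.Build K presented
  pscaleA pscale1 pscaleDr pscaleDl.

Lemma pscaleAl c (x y : presented) : c *: (x * y) = (c *: x) * y.
Proof. by rewrite /GRing.scale /= !pscaleE; exact: pmulA. Qed.

Lemma pscaleAr c (x y : presented) : c *: (x * y) = x * (c *: y).
Proof.
rewrite /GRing.scale /= !pscaleE pcstC -[LHS]pmulA; congr pmul.
by rewrite pcstC.
Qed.

Variable A : algType K.

Fixpoint teval (phi : G -> A) t : A :=
  match t with
  | TGen x => phi x
  | TCst c => c%:A
  | TAdd u v => teval phi u + teval phi v
  | TMul u v => teval phi u * teval phi v
  end.

Definition plift (phi : G -> A) (x : presented) : A := teval phi (repr x).

Lemma teval_cong phi :
  (forall t u, rel t u -> teval phi t = teval phi u) ->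
  forall t u, alg_cong t u -> teval phi t = teval phi u.
Proof.
move=> phi_rel t u; elim => //= {t u}.
- by move=> t u v _ -> _ ->.
- by move=> t t' u u' _ -> _ ->.
- by move=> t t' u u' _ -> _ ->.
- by move=> t u v; rewrite addrA.
- by move=> t u; rewrite addrC.
- by move=> t; rewrite scale0r add0r.
- by move=> t; rewrite scaleN1r mulN1r addNr scale0r.
- by move=> t u v; rewrite mulrA.
- by move=> t; rewrite scale1r mul1r.
- by move=> t u v; rewrite mulrDl.
- by move=> t u v; rewrite mulrDr.
- by move=> a b; rewrite scalerDl.
- by move=> a b; rewrite -scalerAl mul1r scalerA.
- by move=> a t; rewrite -scalerAl -scalerAr mul1r mulr1.
Qed.

Lemma pliftE phi :
  (forall t u, rel t u -> teval phi t = teval phi u) ->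
  forall t, plift phi (tclass t) = teval phi t.
Proof. by move=> phi_rel t; apply: teval_cong phi_rel _ _ (repr_tclass t). Qed.

End PresentedAlgebra.

Arguments tclass {K G}.

Lemma teval_comm (K : fieldType) (G : Type) (A : algType K) (phi : G -> A) t u :
  teval phi (tcomm t u) = teval phi t * teval phi u - teval phi u * teval phi t.
Proof. by rewrite /= scaleN1r mulN1r. Qed.

Lemma teval_sub (K : fieldType) (G : Type) (A : algType K) (phi : G -> A) t u :
  teval phi (tsub t u) = teval phi t - teval phi u.
Proof. by rewrite /= scaleN1r mulN1r. Qed.

(* The Yangian (N = nat) and the Yangian double (N = int). The sign in
   x_{i,r}^{+/-} is a boolean, true standing for +. The parameters are the
   symmetrizers d_i and the Cartan matrix a_ij, both with values in K. *)

Inductive yangian_gen (I N : Type) : Type :=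
| Gxi of I & N
| Gx of bool & I & N.

Arguments Gxi {I N}.
Arguments Gx {I N}.

Section Yangian.
Variables (K : fieldType) (I : finType) (d : I -> K) (a : I -> I -> K).
Variable hbar : K.

Definition sgn (e : bool) : K := if e then 1 else -1.

Section Relations.
Variable N : pzSemiRingType.

Let term := alg_term K (yangian_gen I N).
Let xi i r : term := TGen (Gxi i r).
Let x e i r : term := TGen (Gx e i r).

Inductive yangian_rel : term -> term -> Prop :=
| rel_xi_xi i j r s : yangian_rel (tcomm (xi i r) (xi j s)) (TCst 0)
| rel_xi0_x e i j s :
    yangian_rel (tcomm (xi i 0) (x e j s))
                (tscale (sgn e * (d i * a i j)) (x e j s))
| rel_xi_x e i j r s :
    yangian_rel (tsub (tcomm (xi i (r + 1)) (x e j s))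
                      (tcomm (xi i r) (x e j (s + 1))))
                (tscale (sgn e * hbar * (d i * a i j / 2))
                        (tanticomm (xi i r) (x e j s)))
| rel_x_x e i j r s :
    yangian_rel (tsub (tcomm (x e i (r + 1)) (x e j s))
                      (tcomm (x e i r) (x e j (s + 1))))
                (tscale (sgn e * hbar * (d i * a i j / 2))
                        (tanticomm (x e i r) (x e j s)))
| rel_xp_xm i j r s :
    yangian_rel (tcomm (x true i r) (x false j s))
                (if i == j then xi i (r + s) else TCst 0)
(* Since m%:R = 1 - a i j determines m, this is one relation per i, j, r, s. *)
| rel_serre e i j m (r : 'I_m -> N) s :
    i != j -> m%:R = 1 - a i j ->
    yangian_rel
      (\big[TAdd/TCst 0]_(p : 'S_m)
         foldr (fun k t => tcomm (x e i (r (p k))) t) (x e j s) (enum 'I_m))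
      (TCst 0).

Definition yangian := presented yangian_rel.

HB.instance Definition _ := GRing.PzRing.on yangian.
HB.instance Definition _ := GRing.Lmodule.on yangian.

Definition yxi i r : yangian := tclass _ (xi i r).
Definition yx e i r : yangian := tclass _ (x e i r).

(* Proved by the augmentation that sends every generator to 0. *)
Lemma yangian_nontrivial : (1 : yangian) != 0.
Proof.
pose eps : yangian_gen I N -> K^o := fun=> 0.
have eps_rel t u : yangian_rel t u -> teval eps t = teval eps u.
  have serre0 e i (l : seq N) j s :
      teval eps (foldr (fun k t => tcomm (x e i k) t) (x e j s) l) = 0.
    by elim: l => //= k l ->; rewrite !(mul0r, mulr0, addr0).
  case=> [i j r s|e i j s|e i j r s|e i j r s|i j r s|e i j m r s _ _].
  - by rewrite /= !(mul0r, mulr0, addr0, scale0r).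
  - by rewrite /= !(mul0r, mulr0, addr0, scale0r).
  - by rewrite /= !(mul0r, mulr0, addr0, scale0r).
  - by rewrite /= !(mul0r, mulr0, addr0, scale0r).
  - by case: ifP => _; rewrite /= !(mul0r, mulr0, addr0, scale0r).
  - rewrite /= scale0r (big_morph (teval eps) (id1 := 0) (op1 := +%R)) //=.
      by apply: big1 => p _; rewrite -(foldr_map (fun k => r (p k))
        (fun k t => tcomm (x e i k) t)) serre0.
    by rewrite scale0r.
apply/eqP => /tclass_eq /(teval_cong eps_rel) /=.
by rewrite scale1r scale0r => /eqP; rewrite oner_eq0.
Qed.

HB.instance Definition _ :=
  GRing.PzSemiRing_isNonZero.Build yangian yangian_nontrivial.
HB.instance Definition _ := GRing.Lmodule_isLalgebra.Build K yangian
  (@pscaleAl K _ yangian_rel).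
HB.instance Definition _ := GRing.Lalgebra_isAlgebra.Build K yangian
  (@pscaleAr K _ yangian_rel).

End Relations.
End Yangian.

Arguments yangian_rel {K I} d a hbar N _ _.

Section YangianToDouble.
Variables (K : fieldType) (I : finType) (d : I -> K) (a : I -> I -> K).
Variable hbar : K.

Local Notation Y := (yangian d a hbar nat).
Local Notation DY := (yangian d a hbar int).

Definition iota_gen (x : yangian_gen I nat) : DY :=
  match x with
  | Gxi i r => yxi d a hbar i r%:Z
  | Gx e i r => yx d a hbar e i r%:Z
  end.

Definition yangian_iota : Y -> DY := plift iota_gen.

Fixpoint double_term (t : alg_term K (yangian_gen I nat)) :
    alg_term K (yangian_gen I int) :=
  match t with
  | TGen (Gxi i r) => TGen (Gxi i r%:Z)
  | TGen (Gx e i r) => TGen (Gx e i r%:Z)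
  | TCst c => TCst c
  | TAdd u v => TAdd (double_term u) (double_term v)
  | TMul u v => TMul (double_term u) (double_term v)
  end.

Lemma teval_iota t :
  teval iota_gen t = tclass (yangian_rel d a hbar int) (double_term t).
Proof.
elim: t => [[i r|e i r]|c|t IHt u IHu|t IHt u IHu] //=.
- by rewrite [LHS]pscaleE; exact: (pmul1r (tclass _ _)).
- by rewrite IHt IHu tclassD.
- by rewrite IHt IHu tclassM.
Qed.

Lemma iota_rel t u : yangian_rel d a hbar nat t u ->
  teval iota_gen t = teval iota_gen u.
Proof.
move=> tu; rewrite !teval_iota; apply/tclass_eq/cong_rel.
case: tu => [i j r s|e i j s|e i j r s|e i j r s|i j r s|e i j m r s ij ma] /=.
- exact: rel_xi_xi.
- exact: (rel_xi0_x d a hbar e i j s%:Z).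
- by rewrite !PoszD; exact: (rel_xi_x d a hbar e i j r%:Z s%:Z).
- by rewrite !PoszD; exact: (rel_x_x d a hbar e i j r%:Z s%:Z).
- have := rel_xp_xm d a hbar i j r%:Z s%:Z.
  by case: ifP => _ //=; rewrite PoszD.
- have := rel_serre d hbar e (fun k => (r k)%:Z) s%:Z ij ma.
  rewrite (big_morph double_term (id1 := TCst 0) (op1 := TAdd)) //.
  congr yangian_rel; apply: eq_bigr => p _.
  by elim: (enum _) => //= k l ->.
Qed.

Lemma yangian_iota_is_linear : linear yangian_iota.
Proof.
move=> c x y; rewrite -(tclassK x) -(tclassK y).
have -> : c *: tclass (yangian_rel d a hbar nat) (repr x) + tclass _ (repr y) =
          tclass _ (TAdd (tscale c (repr x)) (repr y)) :> Y.
  by rewrite tclassD tclassM -pscaleE.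
rewrite /yangian_iota !(pliftE iota_rel) /=.
by rewrite -scalerAl mul1r.
Qed.

Lemma yangian_iota_is_monoid_morphism : monoid_morphism yangian_iota.
Proof.
split=> [|x y].
  by rewrite /yangian_iota (pliftE iota_rel) /= scale1r.
rewrite -(tclassK x) -(tclassK y).
have -> : tclass (yangian_rel d a hbar nat) (repr x) * tclass _ (repr y) =
          tclass _ (TMul (repr x) (repr y)) :> Y by rewrite tclassM.
by rewrite /yangian_iota !(pliftE iota_rel).
Qed.

HB.instance Definition _ :=
  GRing.isLinear.Build K Y DY _ yangian_iota yangian_iota_is_linear.
HB.instance Definition _ :=
  GRing.isMonoidMorphism.Build Y DY yangian_iota yangian_iota_is_monoid_morphism.

Lemma yangian_iota_xi i r :
  yangian_iota (yxi d a hbar i r) = yxi d a hbar i r%:Z.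
Proof. exact: (pliftE iota_rel). Qed.

Lemma yangian_iota_x e i r :
  yangian_iota (yx d a hbar e i r) = yx d a hbar e i r%:Z.
Proof. exact: (pliftE iota_rel). Qed.

End YangianToDouble.

(* Not an {lrmorphism A -> 'End(V)}: the library makes 'End(V) an algebra only
   when V is nonzero, and V = 0 is allowed here. *)
Record representation (K : fieldType) (A : algType K) (V : vectType K) := {
  rep_act :> A -> 'End(V);
  rep_linear : linear rep_act;
  rep_one : rep_act 1 = \1%VF;
  rep_mul : forall x y, rep_act (x * y) = (rep_act x \o rep_act y)%VF
}.

Section RationalFunctions.
Variable K : fieldType.
Implicit Types (f : {fraction {poly K}}) (c : nat -> K) (z : K).

Local Notation "x %:F" := (tofrac x).

(* f = \sum_(k >= 0) c k u^-k as u tends to oo: for every n, the remainder of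
   order n vanishes to order at least n at oo. *)
Definition scalar_expansion_infty f c : Prop :=
  forall n, exists p q : {poly K}, [/\ q != 0, (size p + n <= size q)%N &
    f - \sum_(k < n) (c k)%:P%:F / 'X%:F ^+ k = p%:F / q%:F].

(* f = \sum_(k >= 0) c k u^k as u tends to 0. *)
Definition scalar_expansion_zero f c : Prop :=
  forall n, exists p q : {poly K}, q.[0] != 0 /\
    f - \sum_(k < n) (c k)%:P%:F * 'X%:F ^+ k = 'X%:F ^+ n * (p%:F / q%:F).

Definition scalar_pole f z : Prop :=
  ~ exists p q : {poly K}, q.[z] != 0 /\ f = p%:F / q%:F.

Variable W : vectType K.

(* W-valued rational functions, i.e. elements of the tensor product of W and
   K(u), given by their coordinates in a basis of W. *)
Definition ratfun := 'rV[{fraction {poly K}}]_(\dim {:W}).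

Definition coordW (w : W) (k : 'I_(\dim {:W})) : K := coord (vbasis {:W}) k w.

Definition expansion_infty (F : ratfun) (c : nat -> W) : Prop :=
  forall k, scalar_expansion_infty (F 0 k) (fun n => coordW (c n) k).

Definition expansion_zero (F : ratfun) (c : nat -> W) : Prop :=
  forall k, scalar_expansion_zero (F 0 k) (fun n => coordW (c n) k).

Definition pole (F : ratfun) (z : K) : Prop := exists k, scalar_pole (F 0 k) z.

End RationalFunctions.

Section Series.
Variables (K : fieldType) (I : finType) (d : I -> K) (a : I -> I -> K).
Variables (hbar : K) (V : vectType K).

Local Notation Y := (yangian d a hbar nat).
Local Notation DY := (yangian d a hbar int).

Implicit Types (rho : representation Y V) (tau : representation DY V).

(* Coefficients of u^-k in xi_i(u) and x_i^{+/-}(u). *)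
Definition xi_series rho i (k : nat) : 'End(V) :=
  if k is r.+1 then hbar *: rho (yxi d a hbar i r) else \1%VF.

Definition x_series rho e i (k : nat) : 'End(V) :=
  if k is r.+1 then hbar *: rho (yx d a hbar e i r) else 0.

(* Coefficients of u^k in xi_i^-(u) and X_i^{+/-}(u)_-. *)
Definition xi_minus_series tau i (k : nat) : 'End(V) :=
  (if k == 0%N then \1%VF else 0) -
    hbar *: tau (yxi d a hbar i (- (k.+1)%:Z)).

Definition x_minus_series tau e i (k : nat) : 'End(V) :=
  - (hbar *: tau (yx d a hbar e i (- (k.+1)%:Z))).

Local Open Scope classical_set_scope.

(* F is determined by its expansion at oo, so it is the rational function that
   the series represents. *)
Definition sigma_ rho i : set K :=
  [set z | exists F : ratfun 'End(V), pole F z /\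
     (expansion_infty F (xi_series rho i) \/
      exists e, expansion_infty F (x_series rho e i))].

Definition sigma rho : set K := \bigcup_i sigma_ rho i.

Definition extends rho tau : Prop :=
  forall y, rho y = tau (yangian_iota y).

Definition expansion_property rho tau : Prop :=
  forall i,
    (exists F : ratfun 'End(V), expansion_infty F (xi_series rho i) /\
                                expansion_zero F (xi_minus_series tau i)) /\
    (forall e, exists F : ratfun 'End(V),
                                expansion_infty F (x_series rho e i) /\
                                expansion_zero F (x_minus_series tau e i)).

End Series.

Section SimpleLieAlgebra.
Variables (K : numClosedFieldType) (g : vectType K) (br : g -> g -> g).

Definition lie_bracket : Prop :=
  [/\ forall x, linear (br x), forall y, linear (br^~ y), forall x, br x x = 0 &
      forall x y z, br x (br y z) + br y (br z x) + br z (br x y) = 0].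

Definition lie_ideal (U : {vspace g}) : Prop :=
  forall x u, u \in U -> br x u \in U.

Definition simple_lie_algebra : Prop :=
  [/\ lie_bracket, exists x y, br x y != 0 &
      forall U, lie_ideal U -> U = 0%VS \/ U = fullv].

(* A nilpotent subalgebra equal to its own normalizer. *)
Definition cartan_subalgebra (h : {vspace g}) : Prop :=
  [/\ forall x y, x \in h -> y \in h -> br x y \in h,
      exists n, forall (s : seq g) y, size s = n -> {subset s <= h} -> y \in h ->
        foldr br y s = 0 &
      forall x, (forall y, y \in h -> br x y \in h) -> x \in h].

Variable h : {vspace g}.
Local Notation hdual := 'Hom(subvs_of h, K^o).

Definition is_root (l : hdual) : Prop :=
  l != 0 /\ exists2 x : g, x != 0 & forall t, br (vsval t) x = l t *: x.

Definition simple_roots (I : finType) (alpha : I -> hdual) : Prop :=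
  [/\ forall i, is_root (alpha i), basis_of fullv (codom alpha) &
      forall l, is_root l -> exists n : I -> nat,
        l = \sum_i alpha i *+ n i \/ l = - \sum_i alpha i *+ n i].

Variable kappa : g -> g -> K.

Definition invariant_form : Prop :=
  [/\ forall c x y z, kappa (c *: x + y) z = c * kappa x z + kappa y z,
      forall x y, kappa x y = kappa y x &
      forall x y z, kappa (br x y) z = kappa x (br y z)].

(* The form on h^* is transported from h along t |-> kappa t. *)
Definition form_dual (l : hdual) : g :=
  xget 0 [set t | t \in h /\ forall s, kappa t (vsval s) = l s]%classic.

Definition root_form (l m : hdual) : K := kappa (form_dual l) (form_dual m).

Definition short_roots_normalized : Prop :=
  (forall l, is_root l -> 2 <= root_form l l) /\
  (exists l, is_root l /\ root_form l l = 2).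

Variables (I : finType) (alpha : I -> hdual).

Definition cartan_matrix i j : K :=
  2 * root_form (alpha i) (alpha j) / root_form (alpha i) (alpha i).

Definition symmetrizer i : K := root_form (alpha i) (alpha i) / 2.

End SimpleLieAlgebra.

(* Main.v *)
Require Import Defs.
From HB Require Import structures.
From mathcomp Require Import all_boot all_order all_algebra.
From mathcomp Require Import perm complex zify ring.
From mathcomp Require Import boolp classical_sets reals.

(* On a finite-dimensional module the relations between xi_{i,0}, xi_{i,1} and
   x_{i,s} give x_{i,s+1} = T x_{i,s} for a linear operator T on End(V), so each
   sequence x_{i,s} satisfies a linear recurrence with constant coefficients,
   i.e. x_i(u) is rational. It has no pole at 0 exactly when the recurrence can
   be taken with nonzero constant coefficient, and then the sequence extends
   uniquely to negative s; the extended sequence gives the expansion at 0 of the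
   same rational function. Every relation is multilinear in such sequences, and
   a two-sided recurrent sequence that vanishes for all s >= 0 vanishes, so the
   relations extend from nonnegative to all indices. Conversely, over the double
   the recurrence given by T holds for all integer s, so a power of the shift can
   be divided out of it, which makes its constant coefficient nonzero. *)

Set Implicit Arguments.
Unset Strict Implicit.
Unset Printing Implicit Defensive.

Import Order.TTheory GRing.Theory Num.Theory.
Local Open Scope ring_scope.
Local Open Scope classical_set_scope.

(** * Linear recurrences *)

Section Recurrence.
Variable K : fieldType.
Implicit Types (P Q : {poly K}).

(** This is P(S) f for the shift operator (S f)(n) = f(n + 1), which makes two-sided sequences a
    module over K[X]. *)
Definition shift_act (W : lmodType K) P (f : int -> W) (n : int) : W :=
  \sum_(k < size P) P`_k *: f (n + k%:Z).

(** The nonzero constant coefficient lets the recurrence be run backwards, towards negative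
    indices. *)
Definition recurrent (W : lmodType K) (f : int -> W) : Prop :=
  exists2 P, P.[0] != 0 & forall n, shift_act P f n = 0.

Lemma shift_act_wide (W : lmodType K) N P (f : int -> W) n :
  (size P <= N)%N -> shift_act P f n = \sum_(k < N) P`_k *: f (n + k%:Z).
Proof.
move=> sPN; rewrite /shift_act (big_ord_widen N (fun k => P`_k *: f (n + k%:Z))) //.
rewrite big_mkcond; apply: eq_bigr => k _; case: ifPn => //.
by rewrite -leqNgt => kP; rewrite nth_default // scale0r.
Qed.

Lemma shift_actD (W : lmodType K) P Q (f : int -> W) n :
  shift_act (P + Q) f n = shift_act P f n + shift_act Q f n.
Proof.
rewrite (shift_act_wide _ _ (size_polyD P Q)).
rewrite (shift_act_wide _ _ (leq_maxl (size P) (size Q))).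
rewrite (shift_act_wide _ _ (leq_maxr (size P) (size Q))) -big_split /=.
by apply: eq_bigr => k _; rewrite coefD scalerDl.
Qed.

Lemma shift_actZ (W : lmodType K) c P (f : int -> W) n :
  shift_act (c *: P) f n = c *: shift_act P f n.
Proof.
rewrite (shift_act_wide _ _ (size_scale_leq c P)) scaler_sumr.
by apply: eq_bigr => k _; rewrite coefZ scalerA.
Qed.

Lemma shift_actMX (W : lmodType K) P (f : int -> W) n :
  shift_act (P * 'X) f n = shift_act P f (n + 1).
Proof.
have sPX : (size (P * 'X)%R <= (size P).+1)%N.
  by apply/leq_sizeP => -[|j] sj //; rewrite coefMX nth_default.
rewrite (shift_act_wide _ _ sPX) big_ord_recl coefMX scale0r add0r.
by apply: eq_bigr => k _; rewrite coefMX /= -addrA -PoszD.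
Qed.

Lemma shift_actM (W : lmodType K) P Q (f : int -> W) n :
  shift_act (P * Q) f n = shift_act P (shift_act Q f) n.
Proof.
elim/poly_ind: P n => [|P c IHP] n; first by rewrite mul0r /shift_act size_poly0 !big_ord0.
rewrite mulrDl mulrAC !shift_actD !shift_actMX IHP mul_polyC shift_actZ.
by congr (_ + _); rewrite (shift_act_wide _ _ (size_polyC_leq1 c)) big_ord1 coefC addr0.
Qed.

Lemma shift_actMXn (W : lmodType K) P m (f : int -> W) n :
  shift_act (P * 'X^m) f n = shift_act P f (n + m%:Z).
Proof.
elim: m n => [|m IHm] n; first by rewrite mulr1 addr0.
by rewrite exprSr mulrA shift_actMX IHm -addrA -PoszD.
Qed.

Lemma shift_act_linear (W U : lmodType K) (L : W -> U) P (f : int -> W) n :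
  linear L -> shift_act P (L \o f) n = L (shift_act P f n).
Proof.
move=> Llin; pose L' : {linear W -> U} := HB.pack L (GRing.isLinear.Build K W U _ L Llin).
rewrite -[RHS]/(L' _) raddf_sum; apply: eq_bigr => k _.
by rewrite -[RHS]/(L' _) linearZ.
Qed.

Lemma shift_act_seqD (W : lmodType K) P (f g : int -> W) n :
  shift_act P (f \+ g) n = shift_act P f n + shift_act P g n.
Proof. by rewrite /shift_act -big_split /=; apply: eq_bigr => k _; rewrite scalerDr. Qed.

Lemma recurrent_linear (W U : lmodType K) (L : W -> U) (f : int -> W) :
  linear L -> recurrent f -> recurrent (fun n => L (f n)).
Proof.
move=> Llin [P P0 Pf]; exists P => // n; rewrite (shift_act_linear _ f) // Pf.
by have := Llin (-1) 0 0; rewrite scaleN1r addNr scaleN1r addNr.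
Qed.

(** The actions of P and Q commute, so the product P Q annihilates both sequences. *)
Lemma recurrentD (W : lmodType K) (f g : int -> W) :
  recurrent f -> recurrent g -> recurrent (fun n => f n + g n).
Proof.
move=> [P P0 Pf] [Q Q0 Qg]; exists (P * Q); first by rewrite hornerM mulf_neq0.
move=> n; rewrite (shift_act_seqD _ f g) {1}mulrC !shift_actM.
by rewrite /shift_act !big1 ?addr0 // => k _; [rewrite -/(shift_act Q g _) Qg scaler0 |
  rewrite -/(shift_act P f _) Pf scaler0].
Qed.

Lemma recurrent_ext (W : lmodType K) (f g : int -> W) :
  f =1 g -> recurrent f -> recurrent g.
Proof. by move=> /funext ->. Qed.

Lemma recurrent_cst (W : lmodType K) (w : W) : recurrent (fun=> w).
Proof.
exists (1 - 'X); first by rewrite !hornerE subr0 oner_eq0.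
move=> n; have s2 : (size (1 - 'X : {poly K})%R <= 2)%N.
  by rewrite (leq_trans (size_polyD _ _)) // size_polyN size_polyX size_poly1.
rewrite (shift_act_wide _ _ s2) big_ord_recl big_ord1 !coefB !coefX !coef1 /=.
by rewrite subr0 sub0r scale1r scaleN1r subrr.
Qed.

Lemma recurrent_shift (W : lmodType K) (f : int -> W) a :
  recurrent f -> recurrent (fun n => f (n + a)).
Proof.
move=> [P P0 Pf]; exists P => // n; rewrite -[RHS](Pf (n + a)).
by apply: eq_bigr => k _; rewrite addrAC.
Qed.

Lemma recurrent_shiftl (W : lmodType K) (f : int -> W) a :
  recurrent f -> recurrent (fun n => f (a + n)).
Proof. by move=> /(recurrent_shift a); apply: recurrent_ext => n; rewrite addrC. Qed.

(** Write P = Q X^m with Q(0) != 0. The shift is invertible on two-sided sequences, so X^m is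
    cancelled by moving the index from n to n - m. *)
Lemma nonzero_recurrence_recurrent (W : lmodType K) P (f : int -> W) :
  P != 0 -> (forall n, shift_act P f n = 0) -> recurrent f.
Proof.
move=> P0 Pf; have [m [Q]] := multiplicity_XsubC P 0; rewrite P0 subr0 => Q0 PE.
exists Q => // n; have := Pf (n - m%:Z).
by rewrite PE shift_actMXn addrNK.
Qed.

Lemma recurrentZ (W : lmodType K) c (f : int -> W) :
  recurrent f -> recurrent (fun n => c *: f n).
Proof.
apply: recurrent_linear => b u v /=.
by rewrite scalerDr !scalerA mulrC.
Qed.

Lemma recurrentB (W : lmodType K) (f g : int -> W) :
  recurrent f -> recurrent g -> recurrent (fun n => f n - g n).
Proof.
move=> rf /(recurrentZ (-1)) rg; apply: recurrent_ext (recurrentD rf rg) => n /=.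
by rewrite scaleN1r.
Qed.

Lemma recurrent_sum (W : lmodType K) (J : Type) (r : seq J) (p : pred J)
    (f : J -> int -> W) :
  (forall j, recurrent (f j)) -> recurrent (fun n => \sum_(j <- r | p j) f j n).
Proof.
move=> rf; elim: r => [|j r IHr].
  by apply: recurrent_ext (recurrent_cst 0) => n; rewrite big_nil.
case pj: (p j).
  by apply: recurrent_ext (recurrentD (rf j) IHr) => n; rewrite big_cons pj.
by apply: recurrent_ext IHr => n; rewrite big_cons pj.
Qed.

(* The leading term of the recurrence can be solved for since P(0) != 0. *)
Lemma recurrent_eq0 (W : lmodType K) (f : int -> W) :
  recurrent f -> (forall n : nat, f n%:Z = 0) -> forall n, f n = 0.
Proof.
move=> [P P0 Pf] f0.
(* By induction on m: in the recurrence at -m-1 every term but the lowest has index at least -m. *)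
have f0m m j : f (j%:Z - m%:Z) = 0.
  elim: m j => [|m IHm] [|j]; rewrite ?subr0 //; last first.
    by have := IHm j; rewrite -addn1 -(addn1 m) !PoszD opprD addrACA subrr addr0.
  have := Pf (- m.+1%:Z); rewrite /shift_act sub0r.
  have sP : (0 < size P)%N.
    by rewrite lt0n size_poly_eq0; apply: contraNneq P0 => ->; rewrite horner0.
  case: (size P) sP => // s _; rewrite big_ord_recl big1 => [|k _]; last first.
    rewrite (_ : - m.+1%:Z + _ = k%:Z - m%:Z) ?IHm ?scaler0 //.
    by rewrite /= /bump add1n -addn1 -(addn1 k) !PoszD opprD addrC addrACA subrr addr0.
  rewrite !addr0 => /eqP; rewrite scaler_eq0 -horner_coef0 (negPf P0) /=.
  by move=> /eqP.
by case=> [n|n]; [exact: f0 | rewrite NegzE -sub0r; exact: f0m].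
Qed.

(** The indices are released one after the other: for fixed s >= 0 the sequence in r vanishes, and
    then, for any fixed r, the one in s. *)
Lemma recurrent2_eq0 (W : lmodType K) (f : int -> int -> W) :
  (forall s, recurrent (f^~ s)) -> (forall r, recurrent (f r)) ->
  (forall r s : nat, f r%:Z s%:Z = 0) -> forall r s, f r s = 0.
Proof.
move=> rf1 rf2 f0 r; apply: recurrent_eq0 => // s; move: r.
by apply: recurrent_eq0 => // r; exact: f0.
Qed.

Lemma recurrent_extension (W : lmodType K) P (f : nat -> W) :
  P.[0] != 0 -> (forall n, \sum_(k < size P) P`_k *: f (n + k)%N = 0) ->
  exists2 g : int -> W, recurrent g & forall n : nat, g n%:Z = f n.
Proof.
move=> P0 Pf.
(* [back] prepends to a sequence the term that the recurrence forces, and [G k] is the extended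
   sequence read from index -k on. *)
pose back (c : nat -> W) (n : nat) : W := if n is m.+1 then c m else
  - (P`_0)^-1 *: \sum_(k < (size P).-1) P`_k.+1 *: c k.
pose G k := iter k back f.
have GS k m : G k.+1 m.+1 = G k m by [].
have sP : size P = (size P).-1.+1.
  by rewrite prednK // lt0n size_poly_eq0; apply: contraNneq P0 => ->; rewrite horner0.
have PG k n : \sum_(j < size P) P`_j *: G k (n + j)%N = 0.
  elim: k n => [|k IHk] [|n]; rewrite ?Pf //.
    rewrite sP big_ord_recl scalerA /= mulrN mulfV -?horner_coef0 // scaleN1r.
    by apply/eqP; rewrite addrC subr_eq0.
  by rewrite -[RHS](IHk n); apply: eq_bigr => j _; rewrite addSn GS.
pose g (n : int) := match n with Posz m => f m | Negz k => G k.+1 0%N end.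
have gE k m : g (m%:Z - k%:Z) = G k m.
  elim: k m => [|k IHk] [|m]; rewrite ?subr0 //.
    by rewrite sub0r -NegzE.
  rewrite GS -IHk; congr g.
  by rewrite -addn1 -(addn1 k) !PoszD opprD addrACA subrr addr0.
exists g => //; exists P => //.
have Pgk k m : shift_act P g (m%:Z - k%:Z) = 0.
  by rewrite -[RHS](PG k m); apply: eq_bigr => j _; rewrite addrAC -PoszD gE.
by case=> [n|n]; [rewrite -[Posz n]subr0; exact: (Pgk 0%N) |
  rewrite NegzE -sub0r; exact: Pgk].
Qed.

(** The first dim End(W) + 1 powers of T are linearly dependent, and the coefficients of a
    dependence form P. The condition on [f] concerns only indices from n on, so P also serves
    sequences that follow T on nonnegative indices only. *)
Lemma iterated_lfun_recurrence (W : vectType K) (T : 'End(W)) :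
  exists2 P, P != 0 & forall (f : int -> W) n,
    (forall k : nat, f (n + k.+1%:Z) = T (f (n + k%:Z))) -> shift_act P f n = 0.
Proof.
pose N := (\dim {: 'End(W)}).+1.
pose X : N.-tuple 'End(W) := [tuple iter i (comp_lfun T) \1%VF | i < N].
have: ~~ free X.
  by apply/negP => /eqP dX; have := dimvS (subvf <<X>>%VS); rewrite dX size_tuple ltnn.
move=> /freeP Xdep.
have [c cX [i ci]] : exists2 c : 'I_N -> K,
    \sum_(i < N) c i *: X`_i = 0 & exists i, c i != 0.
  apply: contrapT => noc; apply: Xdep => c cX i; apply: contrapT => ci.
  by apply: noc; exists c => //; exists i; apply/eqP.
pose P := \poly_(k < N) c (inord k).
have Pc k : (k < N)%N -> P`_k = c (inord k) by rewrite coef_poly => ->.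
exists P.
  by apply: contra_neq ci => P0; rewrite -(inord_val i) -Pc ?ltn_ord // P0 coef0.
move=> f n fT; rewrite (shift_act_wide _ _ (size_poly _ _)).
have fk k : f (n + k%:Z) = iter k (comp_lfun T) \1%VF (f n).
  elim: k => [|k IHk]; first by rewrite addr0 /= id_lfunE.
  by rewrite fT IHk /= comp_lfunE.
rewrite -[RHS](zero_lfunE _ (f n)) -cX sum_lfunE; apply: eq_bigr => k _.
by rewrite scale_lfunE Pc ?ltn_ord // inord_val fk -tnth_nth tnth_mktuple.
Qed.

End Recurrence.

(** * Expansions of rational functions *)

(** In the application [y] is u^N and [s] is a partial sum in powers of 1/u, so that [s * y] is a
    polynomial while [s] need not be. *)
Lemma cross_multiply (L : fieldType) (p q p' q' y s : L) :
  q != 0 -> q' != 0 -> p / q - s = p' / q' ->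
  (p * y - q * (s * y)) * q' = q * y * p'.
Proof.
move=> q0 q'0 E; have -> : s = p / q - p' / q' by rewrite -E opprB addrC addrNK.
by field; rewrite q0 q'0.
Qed.

Lemma cross_multiply_sub (L : fieldType) (p q p1 q1 p2 q2 : L) :
  q != 0 -> q1 != 0 -> q2 != 0 -> p / q = p1 / q1 - p2 / q2 ->
  p * (q1 * q2) = q * (p1 * q2 - p2 * q1).
Proof.
move=> q0 q10 q20 E; have -> : p = q * (p1 / q1 - p2 / q2) by rewrite -E mulrC divfK.
by field; rewrite q10 q20.
Qed.

Section ScalarExpansions.
Variable K : fieldType.
Implicit Types (p q : {poly K}) (F : {fraction {poly K}}) (b : int -> K^o).
Local Notation "x %:F" := (tofrac x).

Lemma fracP F : exists p q, q != 0 /\ F = p%:F / q%:F.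
Proof.
elim/quotW: F => x; exists (\n_x), (\d_x); split; first exact: denom_ratioP.
have dx := denom_ratioP x; unlock tofrac.
rewrite -[(_^-1)%R]FracField.pi_inv -[RHS]FracField.pi_mul.
rewrite /FracField.mulf /FracField.invf !numden_Ratio ?oner_neq0 //.
by rewrite mulr1 mul1r Ratio_numden.
Qed.

(* The numerator of the polynomial part of q(u) * \sum_k b (a + k) u^(-k-1). *)
Definition tail_numer q b (a : int) : {poly K} :=
  \poly_(m < (size q).-1) \sum_(j < size q) q`_(m.+1 + j) * b (a + j%:Z).

Lemma coef_tail_numer q b a m :
  (tail_numer q b a)`_m = \sum_(j < size q) q`_(m.+1 + j) * b (a + j%:Z).
Proof.
rewrite coef_poly; case: ltnP => // sm; rewrite big1 // => j _.
by rewrite nth_default ?mul0r // (leq_trans (leqSpred _)) // ltnS (leq_trans sm) ?leq_addr.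
Qed.

(** For the tail t_a = sum_k b(a + k) u^(-k-1), this is the polynomial part of q times the identity
    u t_a = t_(a+1) + b(a). The recurrence at [a] enters in the constant coefficient. *)
Lemma tail_numerMX q b a : shift_act q b a = 0 ->
  'X * tail_numer q b a = tail_numer q b (a + 1) + (b a)%:P * q.
Proof.
move=> qb; apply/polyP => m; rewrite coefD coefCM coefXM.
have E k : \sum_(j < size q) q`_(k + j) * b (a + j%:Z) =
    b a * q`_k + \sum_(j < size q) q`_(k.+1 + j) * b (a + 1 + j%:Z).
  have [q0|sq] := posnP (size q).
    by rewrite q0 !big_ord0 nth_default ?mulr0 ?addr0 // q0.
  rewrite -(prednK sq) big_ord_recl [in RHS]big_ord_recr /= addn0 addr0 mulrC.
  rewrite [q`_(k.+1 + (size q).-1)]nth_default ?mul0r ?addr0; last first.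
    by rewrite addSn -addnS prednK ?leq_addl.
  congr (_ + _); apply: eq_bigr => j _.
  by rewrite /= /bump add1n addnS addSn -addrA -PoszD.
case: m => [|m] /=; last by rewrite !coef_tail_numer E addrC.
by rewrite coef_tail_numer addrC -E -[LHS]qb; apply: eq_bigr => j _; rewrite add0n.
Qed.

Lemma tail_numer_div q b a : q != 0 -> shift_act q b a = 0 ->
  'X%:F * ((tail_numer q b a)%:F / q%:F) =
    (tail_numer q b (a + 1))%:F / q%:F + (b a)%:P%:F.
Proof.
move=> q0 qb; rewrite mulrA -tofracM tail_numerMX // tofracD mulrDl tofracM mulfK //.
by rewrite tofrac_eq0.
Qed.

Lemma polyXn_neq0 n : 'X^n != 0 :> {poly K}.
Proof. by rewrite monic_neq0 ?monicXn. Qed.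

Lemma X_frac_neq0 n : ('X%:F ^+ n : {fraction {poly K}}) != 0.
Proof. by rewrite expf_neq0 // tofrac_eq0 polyX_eq0. Qed.

(** By iteration of [tail_numer_div], the terms up to u^-n leave the remainder u^-n t_n, where the
    tail t_n has a numerator of smaller degree than q. *)
Lemma tail_numer_expansion_infty q b c0 : q != 0 ->
  (forall n : nat, shift_act q b n%:Z = 0) ->
  scalar_expansion_infty (c0%:P%:F + (tail_numer q b 0)%:F / q%:F)
    (fun k => if k is r.+1 then b r%:Z else c0).
Proof.
move=> q0 qb [|n].
  exists (c0%:P * q + tail_numer q b 0), q; rewrite big_ord0 subr0 addn0; split=> //.
    rewrite (leq_trans (size_polyD _ _)) // geq_max mul_polyC size_scale_leq.
    by rewrite (leq_trans (size_poly _ _)) ?leq_pred.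
  by rewrite tofracD mulrDl tofracM mulfK ?tofrac_eq0.
exists (tail_numer q b n%:Z), (q * 'X^n); split.
- by rewrite mulf_neq0 // polyXn_neq0.
- rewrite size_mulXn // addnS -addSn addnC leq_add2l.
  rewrite -[X in (_ <= X)%N]prednK ?ltnS ?size_poly //.
  by rewrite lt0n size_poly_eq0.
rewrite big_ord_recl expr0 divr1 opprD addrA [c0%:P%:F + _]addrC addrK.
elim: n => [|n IHn]; first by rewrite big_ord0 subr0 mulr1.
rewrite big_ord_recr /= opprD addrA IHn.
have := tail_numer_div q0 (qb n); rewrite -[Posz n + 1]PoszD addn1 => /(canRL (mulKf _)).
rewrite tofrac_eq0 polyX_eq0 => /(_ isT) E.
rewrite /bump add1n !tofracM !tofracXn !invfM mulrA E exprS invfM.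
rewrite mulrDr mulrDl ['X%:F^-1 * (b n)%:P%:F]mulrC -!mulrA addrK.
by rewrite mulrCA [_ * (q%:F^-1 / _)]mulrCA.
Qed.

(** The same tails are run backwards: t_(-n) = - b(-n-1) + u t_(-n-1). This explains the minus sign
    in the expansion at 0; q(0) != 0 keeps the remainders regular there. *)
Lemma tail_numer_expansion_zero q b c0 : q.[0] != 0 ->
  (forall n, shift_act q b n = 0) ->
  scalar_expansion_zero (c0%:P%:F + (tail_numer q b 0)%:F / q%:F)
    (fun k => (if k == 0%N then c0 else 0) - b (- k.+1%:Z)).
Proof.
move=> q00 qb n.
have q0 : q != 0 by apply: contraNneq q00 => ->; rewrite horner0.
have E : (tail_numer q b 0)%:F / q%:F - \sum_(k < n) (- b (- k.+1%:Z))%:P%:F * 'X%:F ^+ k =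
         'X%:F ^+ n * ((tail_numer q b (- n%:Z))%:F / q%:F).
  elim: n => [|n IHn]; first by rewrite big_ord0 subr0 mul1r.
  rewrite big_ord_recr /= opprD addrA IHn exprS [_ * _ ^+ n]mulrC -mulrA.
  have := tail_numer_div q0 (qb (- n.+1%:Z)).
  rewrite (_ : - n.+1%:Z + 1 = - n%:Z); last first.
    by rewrite -addn1 PoszD opprD addrNK.
  by move=> XR; rewrite [RHS]mulrCA XR polyCN tofracN mulrN opprK mulrDr.
case: n E => [|n] E.
  exists (c0%:P * q + tail_numer q b 0), q; rewrite big_ord0 subr0 mul1r; split=> //.
  by rewrite tofracD mulrDl tofracM mulfK ?tofrac_eq0.
exists (tail_numer q b (- n.+1%:Z)), q; split=> //; rewrite -E.
rewrite !big_ord_recl /= polyCB tofracB mulrBl expr0 mulr1 polyCN tofracN mulr1.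
rewrite !opprD !opprK !addrA; congr (_ + _); last first.
  by congr (- _); apply: eq_bigr => k _; rewrite sub0r.
by rewrite mulr1 opprK [c0%:P%:F + _]addrC addrK.
Qed.

Lemma expansion_infty_recurrence p q c :
  scalar_expansion_infty (p%:F / q%:F) c -> q != 0 ->
  forall n, \sum_(j < size q) q`_j * c (n + j).+1%N = 0.
Proof.
(* With this N, the coefficient of index [size q] in q times the sum of the c_k X^(N-k) pairs q_j
   with c_(n+j+1). *)
move=> pqc q0 n; pose N := (n.+1 + size q)%N.
have [p' [q' [q'0 spq E]]] := pqc N.
pose G := p * 'X^N - q * \sum_(k < N) (c k)%:P * 'X^(N - k).
have GE : G * q' = q * 'X^N * p'.
  apply/eqP; rewrite -tofrac_eq /G !(tofracM, tofracB, tofracXn).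
  have -> : (\sum_(k < N) (c k)%:P * 'X^(N - k))%:F =
      (\sum_(k < N) (c k)%:P%:F / 'X%:F ^+ k) * 'X%:F ^+ N.
    rewrite rmorph_sum mulr_suml; apply: eq_bigr => k _ /=.
    rewrite tofracM tofracXn -mulrA; congr (_ * _).
    rewrite -[X in _ = _ * _ ^+ X](subnK (ltnW (ltn_ord k))) exprD mulrCA.
    by rewrite mulVf ?mulr1 ?X_frac_neq0.
  by apply/eqP/cross_multiply; rewrite ?tofrac_eq0.
(* [G] equals q X^N p' / q', and the degree of p' / q' is at most -N. *)
have sG : (size G <= size q)%N.
  have [->|G0] := eqVneq G 0; first by rewrite size_poly0.
  have p'0 : p' != 0.
    by apply: contraNneq (mulf_neq0 G0 q'0) => p'0; rewrite GE p'0 mulr0.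
  have := congr1 (size : {poly K} -> nat) GE.
  rewrite size_mul // size_mul ?mulf_neq0 ?polyXn_neq0 // size_mulXn //.
  move: spq q0 q'0 G0 p'0; rewrite -!size_poly_gt0; clearbody G N.
  move: (size G) (size q) (size q') (size p') => sG sq sq' sp'; lia.
(* At index [size q] both [G] and [p * 'X^N] have coefficient zero, hence so has q times the sum. *)
have := coefB (p * 'X^N) (q * \sum_(k < N) (c k)%:P * 'X^(N - k)) (size q).
rewrite -/G nth_default // coefMXn /N addSn ltnS leq_addl -addSn -/N /=.
rewrite sub0r => /esym/eqP; rewrite oppr_eq0 => /eqP qc0; rewrite -[RHS]qc0.
rewrite coefM big_ord_recr /= [X in _ = _ + X]mulrC [X in _ = _ + _ * X]nth_default // mulr0 addr0.
apply: eq_bigr => j _; congr (_ * _); rewrite coef_sum.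
have jN : ((n + j).+1 < N)%N by rewrite /N addSn ltnS ltn_add2l.
rewrite (bigD1 (Ordinal jN)) //= coefCM coefXn.
rewrite (_ : _ == _); last by rewrite /N addSn subSS subnDl.
rewrite mulr1 big1 ?addr0 // => k kj; rewrite coefCM coefXn.
case: eqP => [/eqP|]; last by rewrite mulr0.
rewrite -(eqn_add2r k) subnK; last exact: ltnW.
rewrite -(eqn_add2l j) addnA subnKC; last exact: ltnW.
rewrite /N => Ek; case/negP: kj; apply/eqP/val_inj => /=.
by apply/eqP; move: Ek; rewrite addnA [(size q + k)%N]addnC eqn_add2r addnS addnC eq_sym.
Qed.

(** The difference p / q vanishes at infinity to order at least [size q], whereas a nonzero p / q
    vanishes there at most to the order deg q = [size q] - 1. *)
Lemma expansion_infty_unique F F' c :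
  scalar_expansion_infty F c -> scalar_expansion_infty F' c -> F = F'.
Proof.
move=> Fc F'c; apply/eqP; rewrite -subr_eq0.
have [p [q [q0 FE]]] := fracP (F - F').
rewrite FE mulf_eq0 invr_eq0 !tofrac_eq0 (negPf q0) orbF; apply/eqP.
have [p1 [q1 [q10 s1 E1]]] := Fc (size q).
have [p2 [q2 [q20 s2 E2]]] := F'c (size q).
have E : p * (q1 * q2) = q * (p1 * q2 - p2 * q1).
  apply/eqP; rewrite -tofrac_eq !(tofracM, tofracB).
  have : p%:F / q%:F = p1%:F / q1%:F - p2%:F / q2%:F.
    by rewrite -FE -E1 -E2 opprB addrA addrNK.
  by move=> H; apply/eqP/cross_multiply_sub; rewrite ?tofrac_eq0.
have [//|p0] := eqVneq p 0.
have q120 : q1 * q2 != 0 by rewrite mulf_neq0.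
have D0 : p1 * q2 - p2 * q1 != 0.
  by apply: contraNneq (mulf_neq0 p0 q120) => D0; rewrite E D0 mulr0.
have := congr1 (size : {poly K} -> nat) E; rewrite !size_mul //.
have := size_polyD (p1 * q2) (- (p2 * q1)); rewrite size_polyN.
have := size_polyMleq p1 q2; have := size_polyMleq p2 q1.
move: p0 q0 q10 q20 D0 s1 s2; rewrite -!size_poly_gt0.
move: (size (p1 * q2 - _)) (size (p1 * q2)) (size (p2 * q1)).
move: (size p) (size q) (size p1) (size q1) (size p2) (size q2); lia.
Qed.

(** The difference [D] of the two truncations has degree at most n, and it is divisible by X^(n+1)
    because the denominators are prime to X. *)
Lemma expansion_zero_unique F c c' :
  scalar_expansion_zero F c -> scalar_expansion_zero F c' -> c =1 c'.
Proof.
move=> Fc Fc' n.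
have [p1 [q1 [q10 E1]]] := Fc n.+1; have [p2 [q2 [q20 E2]]] := Fc' n.+1.
have q1n0 : q1 != 0 by apply: contraNneq q10 => ->; rewrite horner0.
have q2n0 : q2 != 0 by apply: contraNneq q20 => ->; rewrite horner0.
pose D := \poly_(k < n.+1) (c' k - c k).
have DE : D * (q1 * q2) = 'X^(n.+1) * (p1 * q2 - p2 * q1).
  apply/eqP; rewrite -tofrac_eq !tofracM tofracB !tofracM tofracXn.
  have -> : D%:F = 'X%:F ^+ n.+1 * (p1%:F / q1%:F - p2%:F / q2%:F).
    rewrite mulrBr -E1 -E2 opprB addrC addrA addrNK /D poly_def rmorph_sum -sumrB.
    apply: eq_bigr => k _ /=; rewrite -mul_polyC tofracM tofracXn polyCB tofracB.
    by rewrite mulrBl.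
  rewrite -mulrA; apply/eqP; congr (_ * _); apply/esym.
  have := @cross_multiply_sub _ (p1%:F / q1%:F - p2%:F / q2%:F) 1 p1%:F q1%:F p2%:F q2%:F.
  by rewrite mul1r divr1; move=> ->; rewrite ?oner_neq0 ?tofrac_eq0.
have copX : coprimep 'X^(n.+1) (q1 * q2).
  rewrite coprimep_expl // -['X]subr0 -polyC0 coprimep_sym coprimep_XsubC /root hornerM.
  by rewrite mulf_neq0.
have : 'X^(n.+1) %| D by rewrite -(Gauss_dvdpl _ copX) DE dvdp_mulr.
move/dvdp_leq; rewrite size_polyXn => sD.
have D0 : D = 0.
  apply/eqP; apply: contraT => /sD /leq_trans/(_ (size_poly _ _)).
  by rewrite ltnn.
by have := coef_poly n.+1 (fun k => c' k - c k) n; rewrite -/D D0 coef0 ltnSn =>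
  /esym/eqP; rewrite subr_eq0 => /eqP.
Qed.

End ScalarExpansions.

Section VectorExpansions.
Variables (K : fieldType) (W : vectType K).
Implicit Types (b : int -> W) (F : ratfun W) (c : nat -> W).

Lemma coordW_linear k : linear ((@coordW K W)^~ k : W -> K^o).
Proof. by move=> c u v; rewrite /coordW linearP. Qed.

Lemma coordW_inj (u v : W) : (forall k, coordW u k = coordW v k) -> u = v.
Proof.
move=> uv; rewrite (coord_vbasis (memvf u)) (coord_vbasis (memvf v)).
by apply: eq_bigr => k _; have := uv k; rewrite /coordW => ->.
Qed.

(** Here q may vanish at 0 and the recurrence starts at index 0: this gives rationality before
    anything is known about a pole at 0. *)
Lemma left_recurrence_expansion_infty b (c0 : W) (q : {poly K}) : q != 0 ->
  (forall n : nat, shift_act q b n%:Z = 0) ->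
  exists F, expansion_infty F (fun k => if k is r.+1 then b r%:Z else c0).
Proof.
move=> q0 qb.
pose bk k : int -> K^o := (@coordW K W)^~ k \o b.
exists (\row_k (tofrac (coordW c0 k)%:P + tofrac (tail_numer q (bk k) 0) / tofrac q)).
move=> k; rewrite mxE.
have qbk (n : nat) : shift_act q (bk k) n%:Z = 0.
  rewrite shift_act_linear ?qb; last exact: coordW_linear.
  by rewrite /coordW linear0.
have := tail_numer_expansion_infty (coordW c0 k) q0 qbk.
by congr scalar_expansion_infty; apply/funext => -[].
Qed.

Lemma recurrent_expansion b (c0 : W) : recurrent b ->
  exists F, [/\ ~ pole F 0,
    expansion_infty F (fun k => if k is r.+1 then b r%:Z else c0) &
    expansion_zero F (fun k => (if k == 0%N then c0 else 0) - b (- k.+1%:Z))].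
Proof.
move=> [q q00 qb].
have q0 : q != 0 by apply: contraNneq q00 => ->; rewrite horner0.
pose bk k : int -> K^o := (@coordW K W)^~ k \o b.
have qbk k n : shift_act q (bk k) n = 0.
  rewrite shift_act_linear ?qb; last exact: coordW_linear.
  by rewrite /coordW linear0.
exists (\row_k (tofrac (coordW c0 k)%:P + tofrac (tail_numer q (bk k) 0) / tofrac q)).
split.
- move=> [k]; apply; rewrite mxE.
  exists ((coordW c0 k)%:P * q + tail_numer q (bk k) 0), q; split=> //.
  by rewrite tofracD mulrDl tofracM mulfK ?tofrac_eq0.
- move=> k; rewrite mxE.
  have := tail_numer_expansion_infty (coordW c0 k) q0 (qbk k).
  by congr scalar_expansion_infty; apply/funext => -[].
- move=> k; rewrite mxE.
  have := tail_numer_expansion_zero (coordW c0 k) q00 (qbk k).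
  congr scalar_expansion_zero; apply/funext => m.
  by rewrite /bk /coordW linearB /=; case: (m == _); rewrite // linear0.
Qed.

(** In each coordinate, a denominator that does not vanish at 0 provides a recurrence, which extends
    to negative indices. The denominators may differ; [recurrent_sum] combines them. *)
Lemma regular_expansion_recurrent F c : expansion_infty F c -> ~ pole F 0 ->
  exists2 b, recurrent b & forall n : nat, b n%:Z = c n.+1.
Proof.
move=> Fc np.
have /choice[g gP] : forall k, exists g : int -> K^o,
    recurrent g /\ forall n : nat, g n%:Z = coordW (c n.+1) k.
  move=> k; have [p [q [q0 Fpq]]] : exists p q : {poly K},
      q.[0] != 0 /\ F 0 k = tofrac p / tofrac q.
    by apply: contrapT => nk; apply: np; exists k.
  have qn0 : q != 0 by apply: contraNneq q0 => ->; rewrite horner0.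
  have := Fc k; rewrite Fpq => /expansion_infty_recurrence/(_ qn0) qc.
  have [g rg gE] := @recurrent_extension K K^o q (fun n => coordW (c n.+1) k) q0 qc.
  by exists g.
exists (fun n => \sum_k g k n *: (vbasis {:W})`_k).
  apply: recurrent_sum => k; have [rg _] := gP k.
  apply: (@recurrent_linear K K^o W (fun x => x *: (vbasis {:W})`_k)) rg.
  by move=> x u v; rewrite scalerDl scalerA.
move=> n; rewrite [RHS](coord_vbasis (memvf _)); apply: eq_bigr => k _.
by have [_ ->] := gP k.
Qed.

Lemma ratfun_expansion_unique F F' c :
  expansion_infty F c -> expansion_infty F' c -> F = F'.
Proof.
move=> Fc F'c; apply/rowP => k; exact: expansion_infty_unique (Fc k) (F'c k).
Qed.

Lemma ratfun_expansion_zero_unique F c c' :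
  expansion_zero F c -> expansion_zero F c' -> c =1 c'.
Proof.
by move=> Fc Fc' n; apply: coordW_inj => k; exact: expansion_zero_unique (Fc k) (Fc' k) n.
Qed.

End VectorExpansions.

(** * Representations of algebras given by generators and relations *)

Section Actions.
Variables (K : fieldType) (V : vectType K) (G : Type).
Implicit Types (phi : G -> 'End(V)) (t u : alg_term K G).

(* [teval] does not apply: 'End(V) is not an algType when V may be zero. *)
Fixpoint term_act phi t : 'End(V) :=
  match t with
  | TGen x => phi x
  | TCst c => c *: \1%VF
  | TAdd t u => term_act phi t + term_act phi u
  | TMul t u => (term_act phi t \o term_act phi u)%VF
  end.

Definition commf (f g : 'End(V)) : 'End(V) := (f \o g)%VF - (g \o f)%VF.

Lemma term_act_scale phi c t : term_act phi (tscale c t) = c *: term_act phi t.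
Proof. by rewrite /= -comp_lfunZl comp_lfun1l. Qed.

Lemma term_act_sub phi t u :
  term_act phi (tsub t u) = term_act phi t - term_act phi u.
Proof.
by rewrite -[LHS]/(term_act phi t + term_act phi (tscale (-1) u)) term_act_scale scaleN1r.
Qed.

Lemma term_act_comm phi t u :
  term_act phi (tcomm t u) = commf (term_act phi t) (term_act phi u).
Proof. by rewrite term_act_sub. Qed.

Lemma term_act_cong (rel : alg_term K G -> alg_term K G -> Prop) phi :
  (forall t u, rel t u -> term_act phi t = term_act phi u) ->
  forall t u, alg_cong rel t u -> term_act phi t = term_act phi u.
Proof.
move=> phi_rel t u; elim => //= {t u}.
- by move=> t u v _ -> _ ->.
- by move=> t t' u u' _ -> _ ->.
- by move=> t t' u u' _ -> _ ->.
- by move=> t u v; rewrite addrA.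
- by move=> t u; rewrite addrC.
- by move=> t; rewrite scale0r add0r.
- by move=> t; rewrite -comp_lfunZl comp_lfun1l scaleN1r addNr scale0r.
- by move=> t u v; rewrite comp_lfunA.
- by move=> t; rewrite scale1r comp_lfun1l.
- by move=> t u v; rewrite comp_lfunDl.
- by move=> t u v; rewrite comp_lfunDr.
- by move=> a b; rewrite scalerDl.
- by move=> a b; rewrite -comp_lfunZl comp_lfun1l scalerA.
- by move=> a t; rewrite -comp_lfunZl -comp_lfunZr comp_lfun1l comp_lfun1r.
Qed.

End Actions.

Section YangianActions.
Variables (K : fieldType) (I : finType) (d : I -> K) (a : I -> I -> K).
Variables (hbar : K) (N : pzSemiRingType) (V : vectType K).
Local Notation Y := (yangian d a hbar N).
Local Notation rel := (yangian_rel d a hbar N).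
Local Notation cls := (tclass rel).

Definition gen_act (rho : representation Y V) (x : yangian_gen I N) : 'End(V) :=
  rho (cls (TGen x)).

Lemma rep_tclass (rho : representation Y V) t :
  rho (cls t) = term_act (gen_act rho) t.
Proof.
elim: t => [x|c|t IHt u IHu|t IHt u IHu] //=.
- have -> : cls (TCst c) = c *: (1 : Y) + 0 by rewrite addr0 [RHS]pscaleE [RHS]pmul1r.
  rewrite rep_linear rep_one.
  have := rep_linear rho (-1) 0 0; rewrite scaleN1r addNr scaleN1r addNr => ->.
  by rewrite addr0.
- rewrite tclassD -IHt -IHu; have := rep_linear rho 1 (cls t) (cls u).
  by rewrite !scale1r.
- by rewrite tclassM -IHt -IHu -rep_mul.
Qed.

Lemma rep_rel (rho : representation Y V) t u :
  rel t u -> term_act (gen_act rho) t = term_act (gen_act rho) u.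
Proof. by move=> tu; rewrite -!rep_tclass; congr (rho _); apply/tclass_eq/cong_rel. Qed.

Lemma rep_ext (rho rho' : representation Y V) :
  gen_act rho =1 gen_act rho' -> rho =1 rho'.
Proof. by move=> /funext E x; rewrite -(tclassK x) !rep_tclass E. Qed.

(** The universal property of the presentation: a class acts through its chosen representative, and
    [term_act_cong] makes the choice harmless. *)
Lemma rep_of_gen_act (phi : yangian_gen I N -> 'End(V)) :
  (forall t u, rel t u -> term_act phi t = term_act phi u) ->
  exists rho : representation Y V, gen_act rho = phi.
Proof.
move=> phi_rel; pose r (x : Y) := term_act phi (repr x).
have rE t : r (cls t) = term_act phi t := term_act_cong phi_rel (repr_tclass rel t).
have r_lin : linear r.
  move=> c x y; rewrite -(tclassK x) -(tclassK y).
  have -> : c *: (cls (repr x) : Y) + cls (repr y) =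
      cls (TAdd (tscale c (repr x)) (repr y)) by rewrite tclassD tclassM -pscaleE.
  by rewrite !rE [LHS]/= -comp_lfunZl comp_lfun1l.
have r_one : r 1 = \1%VF by rewrite (rE (TCst 1)) /= scale1r.
have r_mul x y : r (x * y) = (r x \o r y)%VF.
  rewrite -(tclassK x) -(tclassK y).
  have -> : (cls (repr x) : Y) * cls (repr y) = cls (TMul (repr x) (repr y)).
    by rewrite tclassM.
  by rewrite !rE.
by exists (Build_representation r_lin r_one r_mul); apply/funext => x; exact: rE.
Qed.

End YangianActions.

(** * Extension of representations *)

Section RecurrentOperators.
Variables (K : fieldType) (V : vectType K).
Implicit Types (f : int -> 'End(V)) (w : 'End(V)).

Lemma recurrent_compl f w : recurrent f -> recurrent (fun n => (f n \o w)%VF).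
Proof.
apply: (@recurrent_linear _ _ _ (fun v => (v \o w)%VF)) => c u v.
by rewrite comp_lfunDl comp_lfunZl.
Qed.

Lemma recurrent_compr f w : recurrent f -> recurrent (fun n => (w \o f n)%VF).
Proof.
apply: (@recurrent_linear _ _ _ (fun v => (w \o v)%VF)) => c u v.
by rewrite comp_lfunDr comp_lfunZr.
Qed.

Lemma recurrent_commfl f w : recurrent f -> recurrent (fun n => commf (f n) w).
Proof. by move=> rf; apply: recurrentB; [exact: recurrent_compl | exact: recurrent_compr]. Qed.

Lemma recurrent_commfr f w : recurrent f -> recurrent (fun n => commf w (f n)).
Proof. by move=> rf; apply: recurrentB; [exact: recurrent_compr | exact: recurrent_compl]. Qed.

End RecurrentOperators.

Section Yangian.
Variables (K : fieldType) (I : finType) (d : I -> K) (a : I -> I -> K).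
Variables (hbar : K) (V : vectType K).
Hypothesis da_neq0 : forall i, d i * a i i != 0.

Lemma sgn_neq0 e : sgn K e != 0.
Proof. by case: e; rewrite /= ?oppr_eq0 oner_eq0. Qed.

(** The relation between xi_{i,0}, xi_{i,1} and x_{i,s} expresses [xi_{i,0}, x_{i,s+1}] linearly in
    x_{i,s}. This bracket is also c x_{i,s+1} with c = +-d_i a_ii nonzero, so dividing by c gives T,
    independent of s. *)
Lemma shift_operator (N : pzSemiRingType)
    (rho : representation (yangian d a hbar N) V) e i :
  exists T : 'End('End(V)), forall s,
    gen_act rho (Gx e i (s + 1)) = T (gen_act rho (Gx e i s)).
Proof.
pose xi0 := gen_act rho (Gxi i 0); pose xi1 := gen_act rho (Gxi i (0 + 1)).
pose c := sgn K e * (d i * a i i); pose c' := sgn K e * hbar * (d i * a i i / 2).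
pose t (w : 'End(V)) := c^-1 *: (commf xi1 w - c' *: ((xi0 \o w)%VF + (w \o xi0)%VF)).
have t_lin : linear t.
  move=> k u v; pose r w := commf xi1 w - c' *: ((xi0 \o w)%VF + (w \o xi0)%VF).
  rewrite -[t u]/(c^-1 *: r u) -[t v]/(c^-1 *: r v) (scalerA k) mulrC -scalerA.
  rewrite -scalerDr; congr (_ *: _); rewrite {}/r /commf !comp_lfunDl !comp_lfunDr.
  rewrite -!comp_lfunZl -!comp_lfunZr !scalerBr !scalerDr !scalerA [c' * k]mulrC.
  by rewrite !opprD !addrA [LHS](ACl (1*3*5*7*2*4*6*8))/=.
pose t' : {linear 'End(V) -> 'End(V)} :=
  HB.pack t (GRing.isLinear.Build K 'End(V) 'End(V) _ t t_lin).
exists (linfun t') => s; rewrite lfunE /= /t.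
have c0 : c != 0 by rewrite mulf_neq0 ?sgn_neq0.
have := rep_rel rho (rel_xi_x d a hbar e i i 0 s).
rewrite term_act_sub !term_act_comm term_act_scale /= -/xi0 -/xi1 -/c' => <-.
have := rep_rel rho (rel_xi0_x d a hbar e i i (s + 1)).
rewrite term_act_comm term_act_scale /= -/xi0 -/c => ->.
by rewrite subKr scalerA mulVf // scale1r.
Qed.

(** * Modules over the Yangian double *)

Section Doubles.
Variable tau : representation (yangian d a hbar int) V.

Lemma double_x_recurrent e i : recurrent (fun n => gen_act tau (Gx e i n)).
Proof.
have [T xT] := shift_operator tau e i.
have [P P0 PT] := iterated_lfun_recurrence T.
apply: nonzero_recurrence_recurrent P0 _ => n; apply: PT => k.
by rewrite -addn1 PoszD addrA xT.
Qed.

Lemma xi_commf (N : pzSemiRingType)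
    (rho : representation (yangian d a hbar N) V) i r s :
  gen_act rho (Gxi i (r + s)) =
  commf (gen_act rho (Gx true i r)) (gen_act rho (Gx false i s)).
Proof.
have := rep_rel rho (rel_xp_xm d a hbar i i r s).
by rewrite term_act_comm eqxx /= => ->.
Qed.

(** Since xi_{i,n} = [x^+_{i,n}, x^-_{i,0}], this sequence is a linear image of a recurrent one. *)
Lemma double_xi_recurrent i : recurrent (fun n => gen_act tau (Gxi i n)).
Proof.
apply: recurrent_ext (recurrent_commfl (gen_act tau (Gx false i 0)) (double_x_recurrent true i)).
by move=> n; rewrite -xi_commf addr0.
Qed.

Variable rho : representation (yangian d a hbar nat) V.
Hypothesis rho_tau : extends rho tau.

Lemma extends_xi i (r : nat) : gen_act rho (Gxi i r) = gen_act tau (Gxi i r%:Z).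
Proof. by rewrite /gen_act rho_tau yangian_iota_xi. Qed.

Lemma extends_x e i (r : nat) : gen_act rho (Gx e i r) = gen_act tau (Gx e i r%:Z).
Proof. by rewrite /gen_act rho_tau yangian_iota_x. Qed.

(** The two-sided sequence over the double is recurrent, and its rational function has both
    expansions; [rho] supplies the nonnegative half of the sequence. *)
Lemma extends_xi_expansion i :
  exists F, [/\ ~ pole F 0, expansion_infty F (xi_series rho i) &
                expansion_zero F (xi_minus_series tau i)].
Proof.
have [F [np Foo F0]] := recurrent_expansion \1%VF (recurrentZ hbar (double_xi_recurrent i)).
exists F; split=> //.
rewrite (_ : xi_series rho i = (fun k => if k is r.+1 then
  hbar *: gen_act tau (Gxi i r%:Z) else \1%VF)) //.
by apply/funext => -[|r] //=; rewrite -extends_xi.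
Qed.

Lemma extends_x_expansion e i :
  exists F, [/\ ~ pole F 0, expansion_infty F (x_series rho e i) &
                expansion_zero F (x_minus_series tau e i)].
Proof.
have [F [np Foo F0]] := recurrent_expansion 0 (recurrentZ hbar (double_x_recurrent e i)).
exists F; split=> //.
- rewrite (_ : x_series rho e i = (fun k => if k is r.+1 then
    hbar *: gen_act tau (Gx e i r%:Z) else 0)) //.
  by apply/funext => -[|r] //=; rewrite -extends_x.
- rewrite (_ : x_minus_series tau e i = (fun k => (if k == 0%N then 0 else 0) -
    hbar *: gen_act tau (Gx e i (- k.+1%:Z)))) //.
  by apply/funext => k; rewrite if_same sub0r.
Qed.

Lemma extends_expansion_property : expansion_property rho tau.
Proof.
move=> i; split; first by have [F []] := extends_xi_expansion i; exists F.
by move=> e; have [F []] := extends_x_expansion e i; exists F.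
Qed.

(** A rational function is determined by its expansion at infinity, so any function that could
    contribute a pole is the one already known to be regular at 0. *)
Lemma extends_sigma : sigma rho `<=` [set z | z != 0].
Proof.
move=> z [i _ [F [zF Foo]]]; apply/eqP => z0; rewrite {}z0 in zF.
case: Foo => [Foo|[e Foo]].
  have [F' [+ F'oo _]] := extends_xi_expansion i.
  by rewrite (ratfun_expansion_unique F'oo Foo).
have [F' [+ F'oo _]] := extends_x_expansion e i.
by rewrite (ratfun_expansion_unique F'oo Foo).
Qed.

End Doubles.

(** Generators of nonnegative index act as in [rho]. Those of index -r-1 are read off from the
    coefficient of u^r at 0 of a rational function fixed by [rho], after division by [hbar]. *)
Lemma extension_unique rho (tau tau' : representation (yangian d a hbar int) V) :
  hbar != 0 -> extends rho tau -> expansion_property rho tau ->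
  extends rho tau' -> expansion_property rho tau' -> tau' =1 tau.
Proof.
move=> h0 rt pt rt' pt'; apply: rep_ext => -[i|e i] [r|r].
- by rewrite -(extends_xi rt) -(extends_xi rt').
- have [[F [Foo F0]] _] := pt i; have [[F' [F'oo F'0]] _] := pt' i.
  rewrite (ratfun_expansion_unique F'oo Foo) in F'0.
  have := ratfun_expansion_zero_unique F'0 F0 r; rewrite /xi_minus_series -NegzE.
  by move/addrI/oppr_inj/(scalerI h0).
- by rewrite -(extends_x rt) -(extends_x rt').
- have [_ /(_ e)[F [Foo F0]]] := pt i; have [_ /(_ e)[F' [F'oo F'0]]] := pt' i.
  rewrite (ratfun_expansion_unique F'oo Foo) in F'0.
  have := ratfun_expansion_zero_unique F'0 F0 r; rewrite /x_minus_series -NegzE.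
  by move/oppr_inj/(scalerI h0).
Qed.

Lemma restriction (tau : representation (yangian d a hbar int) V) :
  exists rho : representation (yangian d a hbar nat) V, extends rho tau.
Proof.
pose r y := tau (@yangian_iota _ _ d a hbar y).
have r_lin : linear r by move=> c x y; rewrite /r linearP rep_linear.
have r_one : r 1 = \1%VF by rewrite /r rmorph1 rep_one.
have r_mul x y : r (x * y) = (r x \o r y)%VF by rewrite /r rmorphM rep_mul.
by exists (Build_representation r_lin r_one r_mul).
Qed.

(** * Extending an action of the Yangian to its double *)

Section Extension.
Variable rho : representation (yangian d a hbar nat) V.

(** The polynomial P obtained from T may vanish at 0 and yields only rationality. The hypothesis on
    [sigma] then provides denominators that do not vanish at 0, hence a recurrence that can be run
    backwards. *)
Lemma x_recurrent_extension e i : hbar != 0 ->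
  sigma rho `<=` [set z | z != 0] ->
  exists f : int -> 'End(V), recurrent f /\
    forall n : nat, f n%:Z = gen_act rho (Gx e i n).
Proof.
move=> h0 sig; have [T xT] := shift_operator rho e i.
have [P P0 PT] := iterated_lfun_recurrence T.
(* The absolute value gives default values at negative indices; the recurrence is claimed at
   nonnegative ones. *)
pose b n := hbar *: gen_act rho (Gx e i `|n|%N).
have Pb (n : nat) : shift_act P b n%:Z = 0.
  apply: PT => k; rewrite -!PoszD /b !absz_nat linearZ addnS -addn1.
  by congr (_ *: _); exact: xT.
have [F Foo] := left_recurrence_expansion_infty 0 P0 Pb.
have {}Foo : expansion_infty F (x_series rho e i) by [].
have np : ~ pole F 0.
  move=> pF; suff /sig : sigma rho 0 by rewrite /= eqxx.
  by exists i; [exact: Logic.I | exists F; split=> //; right; exists e].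
have [f rf fE] := regular_expansion_recurrent Foo np.
exists (fun n => hbar^-1 *: f n); split; first exact: recurrentZ.
by move=> n; rewrite fE scalerA mulVf // scale1r.
Qed.

Variable x : bool -> I -> int -> 'End(V).
Hypothesis x_rec : forall e i, recurrent (x e i).
Hypothesis xE : forall e i (n : nat), x e i n%:Z = gen_act rho (Gx e i n).

(** The relation at s = 0 is taken as the definition at all integers, so that recurrence in n is
    inherited from x^+. *)
Let xi i n : 'End(V) := commf (x true i n) (x false i 0).
Let phi g : 'End(V) := match g with Gxi i n => xi i n | Gx e i n => x e i n end.

Let xi_rec i : recurrent (xi i).
Proof. exact: recurrent_commfl. Qed.

Let phi_nat t : term_act phi (double_term t) = term_act (gen_act rho) t.
Proof.
elim: t => [[i n|e i n]|c|t IHt u IHu|t IHt u IHu] //=.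
- by rewrite /xi !xE -xi_commf [_ + _]addn0.
- by rewrite IHt IHu.
- by rewrite IHt IHu.
Qed.

Let phi_rel t u : yangian_rel d a hbar nat t u ->
  term_act phi (double_term t) = term_act phi (double_term u).
Proof. by rewrite !phi_nat; exact: rep_rel. Qed.

Let serre_sum e i j m (r : 'I_m -> int) s : 'End(V) :=
  \sum_(p : 'S_m) foldr (fun k w => commf (x e i (r (p k))) w) (x e j s) (enum 'I_m).

Let serre_sumE e i j m (r : 'I_m -> int) s :
  term_act phi (\big[TAdd/TCst 0]_(p : 'S_m)
    foldr (fun k t => tcomm (TGen (Gx e i (r (p k)))) t) (TGen (Gx e j s)) (enum 'I_m)) =
  serre_sum e i j r s.
Proof.
rewrite (big_morph (term_act phi) (id1 := 0) (op1 := +%R)) //=; last by rewrite scale0r.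
apply: eq_bigr => p _; elim: (enum _) => [|k l IHl] //.
rewrite [RHS]/= -IHl; exact: (term_act_comm phi (TGen (Gx e i (r (p k))))). 
Qed.

Let serre_sum_nat e i j m (r : 'I_m -> nat) (s : nat) :
  i != j -> m%:R = 1 - a i j -> serre_sum e i j (fun k => (r k)%:Z) s%:Z = 0.
Proof.
move=> ij ma; have := rep_rel rho (rel_serre d hbar e r s ij ma).
rewrite -!phi_nat /= scale0r (big_morph (@double_term K I) (id1 := TCst 0) (op1 := TAdd)) // => <-.
rewrite -serre_sumE; congr (term_act phi _); apply: eq_bigr => p _.
by elim: (enum _) => //= k l ->.
Qed.

(** As [p] is injective and [l] has no repetition, at most one bracket contains the varying index n,
    so the nested commutator is constant or linear in x_{i,n}. *)
Let foldr_recurrent e i (m : nat) (r : 'I_m -> int) (p : 'S_m) w k (l : seq 'I_m) :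
  uniq l -> let r' n k' := if k' == k then n else r k' in
  recurrent (fun n => foldr (fun k' v => commf (x e i (r' n (p k'))) v) w l).
Proof.
move=> + r'; elim: l => [|h l IHl] /=; first by move=> _; exact: recurrent_cst.
case/andP=> hl ul.
have [hk|hk] := eqVneq (p h) k; last first.
  by under eq_fun do rewrite {1}/r' (negPf hk); apply: recurrent_commfr; exact: IHl.
pose v := foldr (fun k' v => commf (x e i (r (p k'))) v) w l.
apply: recurrent_ext (recurrent_commfl v (x_rec e i)) => n.
rewrite {1}/r' hk eqxx; congr commf; rewrite /v.
(* The inner brackets do not involve n: no other element of the list is sent to k by [p]. *)
elim: l hl {IHl ul v} => //= h' l IHl; rewrite inE negb_or => /andP[hh' hl].
rewrite IHl // {2}/r' -hk (inj_eq perm_inj) eq_sym (negPf hh').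
by [].
Qed.

Let serre_sum_eq0 e i j m (r : 'I_m -> int) s :
  i != j -> m%:R = 1 - a i j -> serre_sum e i j r s = 0.
Proof.
move=> ij ma.
(* The index s is released first, while all entries of r are nonnegative. *)
have nonneg (r' : 'I_m -> nat) s' : serre_sum e i j (fun k => (r' k)%:Z) s' = 0.
  move: s'; apply: recurrent_eq0 => [|s']; last exact: serre_sum_nat.
  apply: recurrent_sum => p; elim: (enum _) => [|k l IHl] //=.
  exact: recurrent_commfr.
(* The list [l] holds the positions whose entries may be negative; it grows by one position at a
   time. *)
suff H (l : seq 'I_m) : forall r', (forall k, k \notin l -> 0 <= r' k) ->
    serre_sum e i j r' s = 0.
  by apply: (H (enum 'I_m)) => k; rewrite mem_enum.
elim: l => [|k l IHl] r' r'0.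
  rewrite (_ : r' = fun k => (`|r' k|%N)%:Z) ?nonneg //.
  by apply/funext => k; rewrite gez0_abs // r'0.
(* The entry at k becomes a free variable n. For n >= 0 the induction hypothesis applies, and
   recurrence in n covers the rest. *)
pose R n k' := if k' == k then n else r' k'.
suff R0 n : serre_sum e i j (R n) s = 0.
  by rewrite -[RHS](R0 (r' k)); congr serre_sum; apply/funext => k'; rewrite /R; case: eqP => // ->.
move: n; apply: recurrent_eq0 => [|n].
  by apply: recurrent_sum => p; apply: foldr_recurrent; exact: enum_uniq.
apply: IHl => k' k'l; rewrite /R; case: eqVneq => // k'k.
by apply: r'0; rewrite inE negb_or k'k.
Qed.

Ltac recurrent_tac := repeat first
  [ exact: x_rec | exact: xi_rec | exact: recurrent_cst
  | exact: recurrent_shift | exact: recurrent_shiftl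
  | apply: recurrentB | apply: recurrentD | apply: recurrentZ
  | apply: recurrent_commfl | apply: recurrent_commfr
  | apply: recurrent_compl | apply: recurrent_compr ].

(** The difference of the two sides is recurrent in each index separately, and at nonnegative
    indices it vanishes because [rho] satisfies the relation. *)
Lemma recurrent_extension_rel t u :
  yangian_rel d a hbar int t u -> term_act phi t = term_act phi u.
Proof.
case=> [i j r s|e i j s|e i j r s|e i j r s|i j r s|e i j m r s ij ma].
- rewrite term_act_comm /= scale0r; move: r s; apply: recurrent2_eq0 => r.
  + by recurrent_tac.
  + by recurrent_tac.
  move=> s; have := phi_rel (rel_xi_xi d a hbar i j r s).
  by rewrite [LHS]term_act_comm /= scale0r.
- rewrite term_act_comm term_act_scale /=; apply/eqP; rewrite -subr_eq0; apply/eqP.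
  move: s; apply: recurrent_eq0 => [|s]; first by recurrent_tac.
  apply/eqP; rewrite subr_eq0; apply/eqP.
  have := phi_rel (rel_xi0_x d a hbar e i j s).
  by rewrite [LHS]term_act_comm [RHS]term_act_scale.
- rewrite term_act_sub !term_act_comm term_act_scale /=; apply/eqP; rewrite -subr_eq0; apply/eqP.
  move: r s; apply: recurrent2_eq0 => r; [by recurrent_tac|by recurrent_tac|move=> s].
  apply/eqP; rewrite subr_eq0; apply/eqP.
  have := phi_rel (rel_xi_x d a hbar e i j r s).
  by rewrite [LHS]term_act_sub ![in LHS]term_act_comm [RHS]term_act_scale.
- rewrite term_act_sub !term_act_comm term_act_scale /=; apply/eqP; rewrite -subr_eq0; apply/eqP.
  move: r s; apply: recurrent2_eq0 => r; [by recurrent_tac|by recurrent_tac|move=> s].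
  apply/eqP; rewrite subr_eq0; apply/eqP.
  have := phi_rel (rel_x_x d a hbar e i j r s).
  by rewrite [LHS]term_act_sub ![in LHS]term_act_comm [RHS]term_act_scale.
- rewrite term_act_comm.
  (* For i = j the right-hand side xi_{i,r+s} is, in either index, a shift of a recurrent
     sequence. *)
  have [<-|ij] := eqVneq i j; apply/eqP; rewrite -subr_eq0; apply/eqP => /=; rewrite ?scale0r;
  move: r s; apply: recurrent2_eq0 => r; try (by recurrent_tac); move=> s;
  apply/eqP; rewrite subr_eq0; apply/eqP.
  + have := phi_rel (rel_xp_xm d a hbar i i r s).
    by rewrite [LHS]term_act_comm eqxx.
  + have := phi_rel (rel_xp_xm d a hbar i j r s).
    by rewrite [LHS]term_act_comm (negPf ij) /= scale0r.
- by rewrite serre_sumE serre_sum_eq0 //= scale0r.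
Qed.

Lemma recurrent_extension_rep :
  exists tau : representation (yangian d a hbar int) V, extends rho tau.
Proof.
have [tau tauE] := rep_of_gen_act recurrent_extension_rel.
exists tau => y; rewrite -(tclassK y) /yangian_iota (pliftE (@iota_rel _ _ _ _ _)).
by rewrite teval_iota !rep_tclass tauE phi_nat.
Qed.

End Extension.

End Yangian.

Theorem proposition8p4 (R : realType)
    (g : vectType R[i]) (br : g -> g -> g) (h : {vspace g})
    (kappa : g -> g -> R[i]) (I : finType)
    (alpha : I -> 'Hom(subvs_of h, R[i]^o)) (hbar : R[i])
    (d := symmetrizer kappa alpha) (a := cartan_matrix kappa alpha)
    (g_simple : simple_lie_algebra br)
    (h_cartan : cartan_subalgebra br h)
    (alpha_simple : simple_roots br alpha)
    (kappa_invariant : invariant_form br kappa)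
    (kappa_normalized : short_roots_normalized br h kappa)
    (hbar_neq0 : hbar != 0) :
  (forall (V : vectType R[i]) (rho : representation (yangian d a hbar nat) V),
     sigma rho `<=` [set z | z != 0] ->
     exists2 rhoD : representation (yangian d a hbar int) V,
       extends rho rhoD /\ expansion_property rho rhoD &
       forall rhoD' : representation (yangian d a hbar int) V,
         extends rho rhoD' -> expansion_property rho rhoD' -> rhoD' =1 rhoD) /\
  (forall (V : vectType R[i]) (rhoD : representation (yangian d a hbar int) V),
     exists rho : representation (yangian d a hbar nat) V,
       [/\ sigma rho `<=` [set z | z != 0], extends rho rhoD &
           expansion_property rho rhoD]).
Proof.
(* This product is (alpha_i, alpha_i), which the normalization bounds below by 2. *)
have da_neq0 i : d i * a i i != 0.
  have [/(_ i) root_i _ _] := alpha_simple; have [/(_ _ root_i) rf2 _] := kappa_normalized.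
  have rf0 : root_form kappa (alpha i) (alpha i) != 0.
    by rewrite gt_eqF // (lt_le_trans _ rf2) ?ltr0n.
  by rewrite /d /a /symmetrizer /cartan_matrix !mulf_neq0 ?invr_neq0 ?pnatr_eq0.
split=> V => [rho sig|rhoD]; last first.
  have [rho ext] := restriction rhoD; exists rho; split=> //.
  - exact: extends_sigma ext.
  - exact: extends_expansion_property ext.
(* Signs and nodes are paired so that one use of choice selects all the two-sided sequences. *)
have /choice[x xP] : forall ei : bool * I, exists f : int -> 'End(V), recurrent f /\
    forall n : nat, f n%:Z = gen_act rho (Gx ei.1 ei.2 n).
  by move=> ei; exact: x_recurrent_extension.
have [rhoD ext] := @recurrent_extension_rep _ _ _ _ _ _ rho (fun e i => x (e, i))
  (fun e i => (xP (e, i)).1) (fun e i => (xP (e, i)).2).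
have expP := extends_expansion_property da_neq0 ext.
by exists rhoD => // rhoD' ext' expP'; exact: extension_unique.
Qed.
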